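(* Let $h:\mathbb C\to\mathbb R$ be any non-constant function, and let $K_h(w,z)=\frac{e^{ih(w)}}{w-z}$ for $w\neq z$. Then there is a real-valued function $\mathcal R_h$, defined on three-tuples of non-collinear points in $\mathbb C$, which is non-constant and invariant under permutations of the elements of $\mathbf z$, such that for any three-tuple $\mathbf z$ of non-collinear points in $\mathbb C$ $$\mathtt S[\mathrm{Re}\,K_h](\mathbf z)=c^2(\mathbf z)\left(\tfrac12+\mathcal R_h(\mathbf z)\right),\qquad \mathtt S[\mathrm{Im}\,K_h](\mathbf z)=c^2(\mathbf z)\left(\tfrac12-\mathcal R_h(\mathbf z)\right).$$ Moreover, if $\mathbf z=(z_1,z_2,z_3)$ is admissible, then $$\mathcal R_h(\mathbf z)=\frac{\ell_1\ell_2\ell_3}{\left(4\,\mathrm{Area}\,\Delta(\mathbf z)\right)^2}\Bigl[\ell_1\cos\bigl(\mathfrak h_{z_1,z_2}(z_1)-\theta_1\bigr)+\ell_2\cos\bigl(\mathfrak h_{z_1,z_2}(z_2)+\theta_2\bigr)-\ell_3\cos\bigl(\mathfrak h_{z_1,z_2}(z_3)+\theta_2-\theta_1\bigr)\Bigr],$$ where $\Delta(\mathbf z)$ is the triangle with vertices $z_1,z_2,z_3$, $\theta_j$ denotes the angle of $\Delta(\mathbf z)$ at $z_j$, $\ell_j$ denotes the length of the side of $\Delta(\mathbf z)$ opposite to $z_j$, and $\mathfrak h_{z_1,z_2}(z):=2h(z)-2\alpha_{21}$ for $z\in\mathbb C$, with $\alpha_{21}$ the principal argument of $z_2-z_1$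.
   Context: For a complex-valued kernel $K(w,z)$ defined for $w\ne z$ in $\mathbb C$ and a three-tuple $\mathbf z=\{z_1,z_2,z_3\}$ of distinct points in $\mathbb C$, the symmetrized form is $$\mathtt S[K](\mathbf z):=\sum_{\sigma\in S_3}K(z_{\sigma(1)},z_{\sigma(2)})\,\overline{K(z_{\sigma(1)},z_{\sigma(3)})},$$ where $S_3$ is the group of permutations of $\{1,2,3\}$. $\mathrm{Re}\,K_h$ and $\mathrm{Im}\,K_h$ are the real and imaginary parts of the kernel $K_h$. The Menger curvature $c(\mathbf z)$ of three non-collinear points is the reciprocal of the radius of the unique circle passing through them; $c^2(\mathbf z)=(c(\mathbf z))^2$. An ordered three-tuple $(a,b,c)$ of non-collinear points in $\mathbb C$ is admissible if (a) the orthogonal projection of $c$ onto the line determined by $a$ and $b$ falls in the interior of the line segment joining $a$ and $b$, and (b) the triangle $\Delta(a,b,c)$ has positive counterclockwise orientation (the vertices $a,b,c$, in this order, are traversed counterclockwise).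
   Formalization: The clause that R_h is non-constant is asserted only when h is non-constant modulo π (some h(x)−h(y) is not an integer multiple of π); otherwise, e.g. h=π at 0 and 0 elsewhere, R_h is identically 0. All other clauses hold for every non-constant h. *)

(* Defs.v *)
From HB Require Import structures.
From mathcomp Require Import all_boot all_order all_algebra all_fingroup.
From mathcomp Require Import complex.
From mathcomp Require Import all_classical all_reals all_analysis.

Set Implicit Arguments.
Unset Strict Implicit.
Unset Printing Implicit Defensive.

Import Order.TTheory GRing.Theory Num.Theory.
Local Open Scope classical_set_scope.
Local Open Scope complex_scope.
Local Open Scope ring_scope.

(* Triples of points are functions z : 'I_3 -> R[i]; the points z_1, z_2, z_3
   of the usual notation are z 0, z 1, z 2. *)

Definition nonconstant_on (T U : Type) (D : set T) (f : T -> U) : Prop :=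
  exists x y : T, [/\ D x, D y & f x <> f y].

(* The symmetrized kernels depend on h only through exp (2 i h), so that R_h
   vanishes identically as soon as h takes its values in a + pi * Z. *)
Definition nonconstant_mod_pi (R : realType) (T : Type) (f : T -> R) : Prop :=
  exists x y : T, forall k : int, f x - f y <> k%:~R * pi.

Section Symmetrization.
Variable R : realType.
Local Notation C := R[i].
Local Notation normc := Normc.normc.

Definition symmetrize (K : C -> C -> C) (z : 'I_3 -> C) : C :=
  \sum_(s : 'S_3) K (z (s 0)) (z (s 1)) * (K (z (s 0)) (z (s 2)))^*%C.

Definition expi (t : R) : C := cos t +i* sin t.

Definition Kh (h : C -> R) (w z : C) : C := expi (h w) / (w - z).

Definition re_kernel (K : C -> C -> C) (w z : C) : C := (complex.Re (K w z))%:C.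
Definition im_kernel (K : C -> C -> C) (w z : C) : C := (complex.Im (K w z))%:C.

(* For v = 0 this says that the three points coincide. *)
Definition collinear (z : 'I_3 -> C) : Prop :=
  exists p v : C, forall j, exists t : R, z j = p + t%:C * v.

Definition noncollinear : set ('I_3 -> C) := [set z | ~ collinear z].

(* The radius of the circle through the three points; [xget] picks it out,
   being well determined when the points are not collinear. *)
Definition circumradius (z : 'I_3 -> C) : R :=
  xget 0 [set r : R | 0 < r /\ exists o : C, forall j, normc (z j - o) = r].

Definition menger (z : 'I_3 -> C) : R := (circumradius z)^-1.

Definition dot (u v : C) : R := complex.Re u * complex.Re v + complex.Im u * complex.Im v.
Definition cross (u v : C) : R := complex.Re u * complex.Im v - complex.Im u * complex.Re v.

(* The point a + t (b - a), with 0 < t < 1, is the orthogonal projection of c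
   onto the line through a and b. *)
Definition projects_inside (a b c : C) : Prop :=
  exists t : R, [/\ 0 < t, t < 1 & dot (c - (a + t%:C * (b - a))) (b - a) = 0].

Definition admissible (z : 'I_3 -> C) : Prop :=
  [/\ noncollinear z, projects_inside (z 0) (z 1) (z 2)
    & 0 < cross (z 1 - z 0) (z 2 - z 0)].

(* Principal argument, in ]-pi, pi], of a nonzero complex number. *)
Definition Arg (u : C) : R :=
  if 0 <= complex.Im u then acos (complex.Re u / normc u) else - acos (complex.Re u / normc u).

(* Angle at the vertex p of the triangle p, q, r. *)
Definition angle (p q r : C) : R :=
  acos (dot (q - p) (r - p) / (normc (q - p) * normc (r - p))).

Definition area (z : 'I_3 -> C) : R :=
  `|cross (z 1 - z 0) (z 2 - z 0)| / 2.

Definition frak_h (h : C -> R) (z1 z2 z : C) : R := 2 * h z - 2 * Arg (z2 - z1).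

Definition admissible_formula (h : C -> R) (z : 'I_3 -> C) : R :=
  let l1 := normc (z 1 - z 2) in
  let l2 := normc (z 0 - z 2) in
  let l3 := normc (z 0 - z 1) in
  let theta1 := angle (z 0) (z 1) (z 2) in
  let theta2 := angle (z 1) (z 0) (z 2) in
  let hh := frak_h h (z 0) (z 1) in
  l1 * l2 * l3 / (4 * area z) ^+ 2 *
  (l1 * cos (hh (z 0) - theta1) + l2 * cos (hh (z 1) + theta2)
   - l3 * cos (hh (z 2) + theta2 - theta1)).

End Symmetrization.

(* Main.v *)
Require Import Defs.
From HB Require Import structures.
From mathcomp Require Import all_boot all_order all_algebra all_fingroup.
From mathcomp Require Import complex.
From mathcomp Require Import all_classical all_reals all_analysis.
From mathcomp Require Import ring lra.

Set Implicit Arguments.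
Unset Strict Implicit.
Unset Printing Implicit Defensive.

Import Order.TTheory GRing.Theory Num.Theory.
Local Open Scope classical_set_scope.
Local Open Scope complex_scope.
Local Open Scope ring_scope.

(** Put [u = z 1 - z 0] and [v = z 2 - z 0], and write [^*] for conjugation.

    The identities for real parts and imaginary parts are two halves of one
    remark.  From [2 Re a Re b = Re (a b^* ) + Re (a b)] and
    [2 Im a Im b = Re (a b^* ) - Re (a b)], the symmetrizations of the real and
    imaginary parts of a kernel [K] are half the sum and half the difference of
    the real parts of [symmetrize K] and of its bilinear analogue
    [symmetrize_sq K], in which no factor is conjugated.  For [K = Kh h] the
    unimodular factor cancels in the sesquilinear form, which is therefore that
    of the Cauchy kernel, and Melnikov's identity [symmetrize_Kh] says that this
    is the squared Menger curvature.  So [remainder h] has to be the real part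
    of [symmetrize_sq (Kh h)] over twice the squared curvature.  It is symmetric
    because both of these are.

    Melnikov's identity is a computation with rational functions of [u], [v] and
    their conjugates, once the curvature is one too: the circumcenter of
    [0, u, v] is [u v (u - v)^* / (u^* v - u v^* )], found by solving the two
    linear equations of the perpendicular bisectors ([circumcenterP]).

    Non-constancy rests on the growth of [remainder h].  With
    [g = exp (2 i h)] the bilinear form is
    [g (z 0) / (u v) + g (z 1) / (u (u - v)) - g (z 2) / (v (u - v))], up to the
    factor 2.  Clearing denominators ([remainder_cross]) equates
    [(2 cross u v)^2 * remainder h z] with the real part of
    [((g (z 1) - g (z 0)) v - (g (z 2) - g (z 0)) u) (u v (u - v))^*].  Suppose
    that [g (z 0) <> g (z 1)], keep these two points and send [z 2] to infinity
    along a line, [v = t p].  Since [g] is bounded, the right-hand side is of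
    order [t^3] for a suitable direction [p], whereas [cross u v ^ 2] is of
    order [t^2]; so [remainder h] cannot keep a constant value.  The
    values of [h] at the points [z 2] enter only through [|g| = 1], so [h] may
    be as irregular as one likes.

    For the formula in terms of angles, let [l1], [l2], [l3] be the sides
    and [alpha] the argument of [u].  Positive orientation gives
    [u = l3 exp (i alpha)], [v = l2 exp (i (alpha + theta1))] and
    [u - v = l1 exp (i (alpha - theta2))], and the three terms of the bilinear
    form become the three cosines. *)

(** * Permutations of three points *)

Lemma sum_S3 (V : nmodType) (F : 'I_3 -> 'I_3 -> 'I_3 -> V) :
  \sum_(s : 'S_3) F (s 0) (s 1) (s 2) =
  F 0 1 2 + F 0 2 1 + F 1 0 2 + F 1 2 0 + F 2 0 1 + F 2 1 0.
Proof.
pose t01 : 'S_3 := tperm 0 1; pose t02 : 'S_3 := tperm 0 2.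
pose t12 : 'S_3 := tperm 1 2.
pose r := [:: 1%g; t12; t01; (t01 * t02)%g; (t02 * t01)%g; t02].
have ur : uniq r.
  apply: (@map_uniq _ _ (fun s : 'S_3 => (s 0, s 1))).
  by rewrite /r /t01 /t02 /t12 /= !(permM, perm1, permE).
have mr s : s \in r.
  apply/negPn/negP => sr.
  have : (size (s :: r) <= #|{: 'S_3}|)%N.
    have /card_uniqP <- : uniq (s :: r) by rewrite cons_uniq sr.
    exact: max_card.
  by rewrite card_Sn.
rewrite (perm_big r) /=; last first.
  apply: uniq_perm => [||s]; rewrite ?index_enum_uniq // mem_index_enum mr //.
rewrite !big_cons big_nil /t01 /t02 /t12 !(permM, perm1, permE) /=.
by rewrite addr0 !addrA.
Qed.

Lemma ord3_ind (P : 'I_3 -> Prop) : P 0 -> P 1 -> P 2 -> forall j, P j.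
Proof.
move=> P0 P1 P2 j; have -> : j = inord j by rewrite inord_val.
case: j => [[|[|[|//]]] /= _].
- by have -> : inord 0 = 0 :> 'I_3 by apply/val_inj; rewrite /= inordK.
- by have -> : inord 1 = 1 :> 'I_3 by apply/val_inj; rewrite /= inordK.
- by have -> : inord 2 = 2 :> 'I_3 by apply/val_inj; rewrite /= inordK.
Qed.

(** * Complex numbers in the plane *)

Section SymmetrizedKernels.
Variable R : realType.
Local Notation C := R[i].
Local Notation cj := (@conjc R).
Local Notation Re := (@complex.Re R).
Local Notation Im := (@complex.Im R).
Local Notation normc := Normc.normc.
Implicit Types (u v w x y : C) (z : 'I_3 -> C).
Implicit Types (K : C -> C -> C) (h : C -> R).

Lemma ReD x y : Re (x + y) = Re x + Re y.
Proof. by case: x y => [a b] [c d]. Qed.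

Lemma ReB x y : Re (x - y) = Re x - Re y.
Proof. by case: x y => [a b] [c d]. Qed.

Lemma ReZ (t : R) x : Re (t%:C * x) = t * Re x.
Proof. by case: x => [a b] /=; rewrite mul0r subr0. Qed.

Lemma Re_sum (I : finType) (F : I -> C) : Re (\sum_i F i) = \sum_i Re (F i).
Proof. by apply: (big_morph Re ReD). Qed.

Lemma normcC_sqr x : (normc x ^+ 2)%:C = x * cj x.
Proof.
case: x => a b; rewrite /normc sqr_sqrtr ?addr_ge0 ?sqr_ge0 //.
by apply/eqP; rewrite eq_complex /=; apply/andP; split; apply/eqP; ring.
Qed.

Lemma normc_ge0 x : 0 <= normc x.
Proof. by case: x => a b; exact: sqrtr_ge0. Qed.

Lemma normc_eq0 x : (normc x == 0) = (x == 0).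
Proof.
by apply/eqP/eqP => [/Normc.eq0_normc|->] //; exact: Normc.normc0.
Qed.

Lemma normc_gt0 x : (0 < normc x) = (x != 0).
Proof. by rewrite lt_def normc_eq0 normc_ge0 andbT. Qed.

Lemma normc_conj x : normc (cj x) = normc x.
Proof. by case: x => a b; rewrite /= sqrrN. Qed.

Lemma Re_le_normc x : `|Re x| <= normc x.
Proof.
case: x => a b /=; rewrite -sqrtr_sqr ler_wsqrtr // lerDl sqr_ge0 //.
Qed.

Lemma conj_mulE u v : cj u * v = dot u v +i* cross u v.
Proof.
case: u v => [a b] [c d]; rewrite /dot /cross.
by apply/eqP; rewrite eq_complex /=; apply/andP; split; apply/eqP; ring.
Qed.

(** This is [4 i] times the signed area of the triangle [0, u, v]; being a
    polynomial in [u], [v] and their conjugates, it lets rational identities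
    be checked without separating real and imaginary parts. *)
Definition area_form u v : C := cj u * v - u * cj v.

Lemma conjc_area_form u v : cj (area_form u v) = - area_form u v.
Proof. rewrite /area_form rmorphB !rmorphM /= !conjcK; ring. Qed.

Lemma area_formE u v : area_form u v = 0 +i* (2 * cross u v).
Proof.
case: u v => [a b] [c d]; rewrite /area_form /cross.
by apply/eqP; rewrite eq_complex /=; apply/andP; split; apply/eqP; ring.
Qed.

Lemma area_form_neq0 u v : (area_form u v != 0) = (cross u v != 0).
Proof. by rewrite area_formE eq_complex /= eqxx /= mulf_eq0 pnatr_eq0. Qed.

Lemma area_form_sqr u v : area_form u v ^+ 2 = - ((2 * cross u v) ^+ 2)%:C.
Proof.
rewrite area_formE expr2.
by apply/eqP; rewrite eq_complex /=; apply/andP; split; apply/eqP; ring.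
Qed.

Lemma sides_neq0 u v : area_form u v != 0 -> [/\ u != 0, v != 0 & u - v != 0].
Proof.
move=> a0; split; apply: contraNneq a0.
- by move=> ->; rewrite /area_form rmorph0 !mul0r subr0.
- by move=> ->; rewrite /area_form rmorph0 !mulr0 subr0.
- by move/eqP; rewrite subr_eq0 => /eqP ->; rewrite /area_form mulrC subrr.
Qed.

(** If [cross u v = 0] with [u = z 1 - z 0] nonzero, then
    [v = (dot u v / |u|^2) u] because [u^* v] is the real number [dot u v]. *)
Lemma noncollinearE z :
  noncollinear z <-> cross (z 1 - z 0) (z 2 - z 0) != 0.
Proof.
split=> [nc|c0 [p [v zE]]]; last first.
  have [t0 e0] := zE 0; have [t1 e1] := zE 1; have [t2 e2] := zE 2.
  move/eqP: c0; apply; rewrite e0 e1 e2 /cross.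
  by case: p v {zE e0 e1 e2} => [p q] [v w] /=; ring.
apply/negP => /eqP c0; apply: nc.
case: (eqVneq (z 1) (z 0)) => [e10|n10].
  exists (z 0), (z 2 - z 0); apply: ord3_ind; [exists 0|exists 0|exists 1].
  - by rewrite mul0r addr0.
  - by rewrite mul0r addr0.
  - by rewrite mul1r addrC subrK.
set u := z 1 - z 0 in c0; set v := z 2 - z 0 in c0.
have u0 : u != 0 by rewrite subr_eq0.
exists (z 0), u; apply: ord3_ind;
  [exists 0|exists 1|exists (dot u v / normc u ^+ 2)].
- by rewrite mul0r addr0.
- by rewrite mul1r addrC subrK.
- rewrite rmorphM fmorphV /= normcC_sqr; apply/eqP; rewrite addrC -subr_eq -/v.
  have := conj_mulE u v; rewrite c0 complexr0 => <-.
  by apply/eqP; field; rewrite conjc_eq0 u0.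
Qed.

(** * Circumscribed circle and Menger curvature *)

Definition circumcenter u v : C := u * v * cj (u - v) / area_form u v.

(** Subtracting [|w|^2] from [|u - w|^2] and from [|v - w|^2] leaves two linear
    equations in [w] and its conjugate; eliminating the conjugate gives
    [circumcenter u v].  Conversely its distances to [0], [u] and [v] all have
    the modulus of [u v (u - v) / area_form u v]. *)
Lemma circumcenterP u v w : area_form u v != 0 ->
  (normc (- w) = normc (u - w) /\ normc (- w) = normc (v - w))
  <-> w = circumcenter u v.
Proof.
move=> a0; split=> [[eu ev]|->].
  have polarize x :
      normc (- w) = normc (x - w) -> x * cj x = w * cj x + x * cj w.
    move=> ex; have := normcC_sqr (- w).
    rewrite ex normcC_sqr !rmorphB /= rmorphN /=.
    by move/eqP; rewrite -subr_eq0 => /eqP e; apply: subr0_eq; rewrite -e; ring.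
  have {}eu := polarize _ eu; have {}ev := polarize _ ev.
  apply: (mulIf a0); rewrite mulfVK //.
  have -> : u * v * cj (u - v) = u * cj u * v - v * cj v * u.
    by rewrite rmorphB /=; ring.
  by rewrite eu ev /area_form; ring.
have eu : u - circumcenter u v = - (u * cj v * (u - v) / area_form u v).
  apply: (mulIf a0); rewrite mulrBl mulNr !mulfVK // rmorphB /area_form /=.
  by ring.
have ev : v - circumcenter u v = - (cj u * v * (u - v) / area_form u v).
  apply: (mulIf a0); rewrite mulrBl mulNr !mulfVK // rmorphB /area_form /=.
  by ring.
by rewrite eu ev !normcN !Normc.normcM !normc_conj.
Qed.

Lemma circumradiusE z : noncollinear z ->
  circumradius z = normc (circumcenter (z 1 - z 0) (z 2 - z 0)).
Proof.
move=> /noncollinearE; rewrite -area_form_neq0.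
set u := z 1 - z 0; set v := z 2 - z 0 => a0.
have split_o (o : C) : [/\ z 0 - o = - (o - z 0), z 1 - o = u - (o - z 0)
    & z 2 - o = v - (o - z 0)].
  by rewrite /u /v; split; ring.
apply: xget_unique.
  split.
    rewrite normc_gt0 /circumcenter.
    have [u0 v0 uv0] := sides_neq0 a0.
    by rewrite !mulf_neq0 ?invr_eq0 ?conjc_eq0.
  exists (z 0 + circumcenter u v).
  have [e0 e1 e2] := split_o (z 0 + circumcenter u v).
  have [_ /(_ erefl)[nu nv]] := circumcenterP (circumcenter u v) a0.
  apply: ord3_ind; rewrite ?(e0, e1, e2) [z 0 + _]addrC addrK.
  - by rewrite normcN.
  - by rewrite -nu normcN.
  - by rewrite -nv normcN.
move=> r [_ [p eo]]; have [e0 e1 e2] := split_o p.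
have [toc _] := circumcenterP (p - z 0) a0.
rewrite -toc; last by rewrite -e1 -e2 -e0 !eo.
by rewrite -(eo 0) e0 normcN.
Qed.

Lemma menger_sqr z : noncollinear z ->
  let u := z 1 - z 0 in let v := z 2 - z 0 in
  (menger z ^+ 2)%:C =
  - area_form u v ^+ 2 / (u * cj u * (v * cj v) * ((u - v) * cj (u - v))).
Proof.
move=> nc u v; rewrite /menger circumradiusE // -/u -/v /circumcenter.
rewrite Normc.normcM Normc.normcV !Normc.normcM normc_conj.
have -> : - area_form u v ^+ 2 = area_form u v * cj (area_form u v).
  by rewrite conjc_area_form; ring.
rewrite -!normcC_sqr -!rmorphM -fmorphV -rmorphM /=.
by congr _%:C; rewrite invfM invrK exprMn exprVn !exprMn mulrC.
Qed.

(** The classical [c = 4 Area / (l1 l2 l3)], squared. *)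
Lemma menger_cross z : noncollinear z ->
  let u := z 1 - z 0 in let v := z 2 - z 0 in
  menger z ^+ 2 * normc (u * v * (u - v)) ^+ 2 = (2 * cross u v) ^+ 2.
Proof.
move=> nc u v; apply: complexI; rewrite rmorphM /= menger_sqr // -/u -/v.
rewrite area_form_sqr opprK normcC_sqr.
move/noncollinearE: nc; rewrite -area_form_neq0 => /sides_neq0.
rewrite -/u -/v => -[u0 v0 uv0].
have [u'0 v'0 uv'0] : [/\ cj u != 0, cj v != 0 & cj (u - v) != 0].
  by rewrite !conjc_eq0.
clearbody u v; rewrite !rmorphM /=.
move: (cj u) (cj v) (cj (u - v)) u'0 v'0 uv'0 => u' v' w' u'0 v'0 w'0.
by field; rewrite u0 v0 uv0 u'0 v'0 w'0.
Qed.

Lemma menger_neq0 z : noncollinear z -> menger z != 0.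
Proof.
move=> nc; have := menger_sqr nc.
move: nc => /noncollinearE; rewrite -area_form_neq0 => a0.
have [u0 v0 uv0] := sides_neq0 a0.
move=> e; apply: contraTneq a0 => m0; move/eqP: e.
rewrite m0 expr0n /= eq_sym mulf_eq0 oppr_eq0 expf_eq0 /= invr_eq0.
by rewrite !mulf_eq0 !conjc_eq0 (negPf u0) (negPf v0) (negPf uv0) !orbF => ->.
Qed.

Lemma circumradius_perm z (s : 'S_3) : circumradius (z \o s) = circumradius z.
Proof.
rewrite /circumradius; congr (xget _ _); apply/predeqP => r /=.
split=> -[r0 [p ep]]; split=> //; exists p => j; last exact: ep.
by rewrite -(ep (s^-1 j)%g) /= permKV.
Qed.

(** * Unimodular numbers and arguments *)

Lemma expiD (s t : R) : expi (s + t) = expi s * expi t.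
Proof.
apply/eqP; rewrite eq_complex /= cosD sinD eqxx /=.
by rewrite addrC.
Qed.

Lemma expiN (t : R) : expi (- t) = cj (expi t).
Proof. by rewrite /expi cosN sinN. Qed.

Lemma expi_mul_conj (t : R) : expi t * cj (expi t) = 1.
Proof.
apply/eqP; rewrite eq_complex /= mulrN opprK -!expr2 cos2Dsin2 eqxx /=.
by rewrite mulrN mulrC addrC subrr.
Qed.

Lemma normc_expi (t : R) : normc (expi t) = 1.
Proof. by rewrite /expi /= cos2Dsin2 sqrtr1. Qed.

Lemma expi_neq0 (t : R) : expi t != 0.
Proof. by rewrite -normc_gt0 normc_expi ltr01. Qed.

Lemma conj_expi (t : R) : cj (expi t) = (expi t)^-1.
Proof.
by apply: (mulfI (expi_neq0 t)); rewrite expi_mul_conj divff ?expi_neq0.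
Qed.

Lemma conj_polar (r t : R) : cj (r%:C * expi t) = r%:C * (expi t)^-1.
Proof. by rewrite rmorphM -conj_expi; congr (_ * _); exact: conjc_real. Qed.

(** [cos (2 d) = 1 - 2 (sin d)^2] forces [sin d = 0] for [d = s - t]; the
    representative of [d] modulo [pi] in the half-open interval from [0] to
    [pi] then has a vanishing sine, hence is [0]. *)
Lemma expi2_inj_mod_pi (s t : R) : expi (2 * s) = expi (2 * t) ->
  exists k : int, s - t = k%:~R * pi.
Proof.
move=> st; set d := s - t.
have [cd _] : expi (2 * d) = expi (0 : R).
  have -> : 2 * d = 2 * s + - (2 * t) by rewrite /d; ring.
  by rewrite expiD expiN st expi_mul_conj /expi cos0 sin0.
have sd : sin d = 0.
  move: cd; rewrite mulr_natl mulr2n cosD -!expr2 cos2sin2 cos0 => cd.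
  by apply/eqP; rewrite -sqrf_eq0; apply/eqP; lra.
have pi0 := pi_gt0 R; set k := Num.floor (d / pi); exists k.
have /andP[kd dk] := floor_itv (d / pi).
set e := d - k%:~R * pi.
have se : sin e = 0.
  case kE: k => [n|n].
    have := alternatingn (@sinDpi R) n e.
    have -> : e + pi *+ n = d by rewrite /e kE -pmulrn mulr_natl subrK.
    by rewrite sd => /esym/eqP; rewrite mulf_eq0 signr_eq0 => /eqP.
  have -> : e = d + pi *+ n.+1.
    by rewrite /e kE NegzE mulrNz mulNr opprK -pmulrn mulr_natl.
  by rewrite (alternatingn (@sinDpi R)) sd mulr0.
apply/eqP; rewrite -subr_eq0 -/e; apply/negPn/negP => e0.
have : 0 < sin e.
  apply: sin_gt0_pi; rewrite lt_def e0 /=.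
  rewrite /e subr_ge0 -ler_pdivlMr // kd ltrBlDl /=.
  by move: dk; rewrite ltr_pdivrMr // intrD mulrDl mul1r addrC.
by rewrite se ltxx.
Qed.

Lemma expi_Arg w : w != 0 -> (normc w)%:C * expi (Arg w) = w.
Proof.
rewrite -normc_gt0 => n0; have n_neq0 := lt0r_neq0 n0.
set c := Re w / normc w.
have sqn : (Re w) ^+ 2 + (Im w) ^+ 2 = normc w ^+ 2.
  by case: (w) => a b /=; rewrite sqr_sqrtr ?addr_ge0 ?sqr_ge0.
have c1 : -1 <= c <= 1.
  rewrite -ler_norml normrM normfV (gtr0_norm n0) ler_pdivrMr // mul1r.
  exact: Re_le_normc.
have sE : sin (acos c) = `|Im w| / normc w.
  rewrite sin_acos // /c -[RHS]ger0_norm ?divr_ge0 ?normc_ge0 // -sqrtr_sqr.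
  congr (Num.sqrt _); rewrite !expr_div_n real_normK ?num_real //.
  rewrite -[in LHS](@divff _ (normc w ^+ 2)) ?expf_neq0 //.
  by rewrite -mulrBl -sqn addrC addKr.
have cE : cos (acos c) = c by rewrite acosK // in_itv.
rewrite /Arg -/c; case: ifPn => [i0|]; last rewrite -ltNge => i0.
  rewrite /expi cE sE ger0_norm //; apply/eqP; rewrite eq_complex /=.
  by rewrite !mul0r subr0 addr0 /c ![normc w * _]mulrC !mulfVK // !eqxx.
rewrite expiN /expi /= cE sE ltr0_norm //; apply/eqP; rewrite eq_complex /=.
rewrite !mul0r subr0 addr0 /c mulNr opprK.
by rewrite ![normc w * _]mulrC !mulfVK // !eqxx.
Qed.

(** * Sesquilinear and bilinear symmetrizations *)

Definition symmetrize_sq K z : C :=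
  \sum_(s : 'S_3) K (z (s 0)) (z (s 1)) * K (z (s 0)) (z (s 2)).

Lemma symmetrize_re_kernel K z :
  symmetrize (re_kernel K) z =
  ((Re (symmetrize K z) + Re (symmetrize_sq K z)) / 2)%:C.
Proof.
rewrite !Re_sum -big_split /= mulr_suml rmorph_sum /=; apply: eq_bigr => s _.
rewrite /re_kernel; case: (K _ _) (K _ _) => [a b] [c d] /=.
by apply/eqP; rewrite eq_complex /=; apply/andP; split; apply/eqP; field.
Qed.

Lemma symmetrize_im_kernel K z :
  symmetrize (im_kernel K) z =
  ((Re (symmetrize K z) - Re (symmetrize_sq K z)) / 2)%:C.
Proof.
rewrite !Re_sum -sumrB mulr_suml rmorph_sum /=; apply: eq_bigr => s _.
rewrite /im_kernel; case: (K _ _) (K _ _) => [a b] [c d] /=.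
by apply/eqP; rewrite eq_complex /=; apply/andP; split; apply/eqP; field.
Qed.

(** Melnikov's identity; the phases disappear since [Kh h w d] and
    [Kh h w e] carry the same one. *)
Lemma symmetrize_Kh h z : noncollinear z ->
  symmetrize (Kh h) z = (menger z ^+ 2)%:C.
Proof.
move=> nc; rewrite menger_sqr //.
move: nc => /noncollinearE; rewrite -area_form_neq0 => a0.
have unimod (w d e : C) :
    Kh h w d * cj (Kh h w e) = (w - d)^-1 * (cj (w - e))^-1.
  rewrite /Kh rmorphM fmorphV /= mulrACA expi_mul_conj mul1r //.
rewrite /symmetrize; under eq_bigr do rewrite unimod.
rewrite (sum_S3 (fun i j k => (z i - z j)^-1 * (cj (z i - z k))^-1)).
have [] := sides_neq0 a0; move: a0.
set u := z 1 - z 0; set v := z 2 - z 0 => a0 u0 v0 uv0.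
have -> : z 0 - z 1 = - u by rewrite opprB.
have -> : z 0 - z 2 = - v by rewrite opprB.
have -> : z 1 - z 2 = u - v by rewrite /u /v; ring.
have -> : z 2 - z 1 = - (u - v) by rewrite /u /v; ring.
clearbody u v; rewrite /area_form !rmorphN !rmorphB /=.
have := u0; have := v0; have := uv0.
rewrite -conjc_eq0 -(conjc_eq0 u) -(conjc_eq0 v) rmorphB /=.
move: (cj u) (cj v) => u' v' uv'0 v'0 u'0.
by field; rewrite u0 v0 u'0 v'0 uv0 uv'0.
Qed.

(** The normalization is forced: the difference of the symmetrizations of
    the real and imaginary parts is the real part of [symmetrize_sq (Kh h) z],
    and it has to be [2 c^2] times the remainder. *)
Definition remainder h z : R :=
  Re (symmetrize_sq (Kh h) z) / (2 * menger z ^+ 2).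

Lemma remainder_re h z : noncollinear z ->
  symmetrize (re_kernel (Kh h)) z =
  (menger z ^+ 2 * (1 / 2 + remainder h z))%:C.
Proof.
move=> nc; rewrite symmetrize_re_kernel symmetrize_Kh //= /remainder.
by congr _%:C; field; exact: menger_neq0.
Qed.

Lemma remainder_im h z : noncollinear z ->
  symmetrize (im_kernel (Kh h)) z =
  (menger z ^+ 2 * (1 / 2 - remainder h z))%:C.
Proof.
move=> nc; rewrite symmetrize_im_kernel symmetrize_Kh //= /remainder.
by congr _%:C; field; exact: menger_neq0.
Qed.

Lemma remainder_perm h z (s : 'S_3) : remainder h (z \o s) = remainder h z.
Proof.
rewrite /remainder /menger circumradius_perm; congr (Re _ / _).
rewrite [RHS](reindex_inj (mulIg s)) /=.
by apply: eq_bigr => t _; rewrite !permM.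
Qed.

Definition phase h w : C := expi (2 * h w).

(** Only [exp (2 i h)] survives in the bilinear form, and the six
    permutations give each of the three terms twice. *)
Lemma remainder_menger h z : noncollinear z ->
  let u := z 1 - z 0 in let v := z 2 - z 0 in
  menger z ^+ 2 * remainder h z =
  Re (phase h (z 0) / (u * v) + phase h (z 1) / (u * (u - v))
      - phase h (z 2) / (v * (u - v))).
Proof.
move=> nc u v; have m0 := menger_neq0 nc.
have -> : menger z ^+ 2 * remainder h z = Re (symmetrize_sq (Kh h) z) / 2.
  by rewrite /remainder; field.
have sq (w d e : C) :
    Kh h w d * Kh h w e = phase h w * ((w - d)^-1 * (w - e)^-1).
  by rewrite /Kh /phase mulrACA -expiD -mulr2n mulr_natl.
rewrite /symmetrize_sq; under eq_bigr do rewrite sq.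
rewrite (sum_S3
  (fun i j k => phase h (z i) * ((z i - z j)^-1 * (z i - z k)^-1))).
move/noncollinearE: nc; rewrite -area_form_neq0 => /sides_neq0.
rewrite -/u -/v => -[u0 v0 uv0].
have -> : z 0 - z 1 = - u by rewrite opprB.
have -> : z 0 - z 2 = - v by rewrite opprB.
have -> : z 1 - z 2 = u - v by rewrite /u /v; ring.
have -> : z 2 - z 1 = - (u - v) by rewrite /u /v; ring.
clearbody u v; set p0 := phase h _; set p1 := phase h _; set p2 := phase h _.
rewrite mulrC -ReZ fmorphV /= rmorph_nat; congr (Re _).
by field; rewrite u0 v0 uv0.
Qed.

(** Expressed through differences of phases, so that the limit [z 2 -> oo]
    can be read off: the numerator gains one more power of [z 2] than
    [cross u v ^ 2] when [G 1 <> 0]. *)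
Lemma remainder_cross h z : noncollinear z ->
  let u := z 1 - z 0 in let v := z 2 - z 0 in
  let G j := phase h (z j) - phase h (z 0) in
  (2 * cross u v) ^+ 2 * remainder h z =
  Re ((G 1 * v - G 2 * u) * cj (u * v * (u - v))).
Proof.
move=> nc u v G; rewrite -menger_cross // -/u -/v mulrAC.
rewrite remainder_menger // -/u -/v.
move/noncollinearE: nc; rewrite -area_form_neq0 => /sides_neq0.
rewrite -/u -/v => -[u0 v0 uv0].
rewrite mulrC -ReZ normcC_sqr; congr (Re _); rewrite /G.
clearbody u v; move: (phase h _) (phase h _) (phase h _) (cj _) => p0 p1 p2 c.
by field; rewrite u0 v0 uv0.
Qed.

(** * Growth of the remainder at infinity *)

Lemma linear_bound_le0 (a b : R) : (forall t, 1 <= t -> t * a <= b) -> a <= 0.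
Proof.
move=> ub; rewrite leNgt; apply/negP => a0.
have b0 : 0 <= b by apply: le_trans (ub 1 (lexx 1)); rewrite mul1r ltW.
have := ub (1 + b / a); rewrite lerDl divr_ge0 ?(ltW a0) // => /(_ isT).
by rewrite mulrDl mul1r mulfVK ?gt_eqF // gerDr leNgt a0.
Qed.

(** The directions with [0 < dot w p] form an open half-plane, which a line
    cannot contain; adding to [w] a quarter turn of [u], in the right sense,
    gives one of them off the line of [u]. *)
Lemma direction_exists u w : u != 0 -> w != 0 ->
  exists p, 0 < dot w p /\ cross u p != 0.
Proof.
move=> u0 w0.
have dot_gt0 x : x != 0 -> 0 < dot x x.
  by move=> x0; rewrite /dot -!expr2; case: x x0 => a b; rewrite eq_complex /=;
   rewrite lt_def addr_ge0 ?sqr_ge0 // andbT paddr_eq0 ?sqr_ge0 // !sqrf_eq0.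
pose iu : C := (- Im u) +i* (Re u).
(* With this sign [s * cross u w] is nonnegative, so that nothing cancels in
   [|w|^2 + s cross u w] and [cross u w + s |u|^2], the two quantities of
   interest at [w + s iu]. *)
pose s : R := if 0 <= cross u w then 1 else -1.
exists (w + s%:C * iu).
have -> : dot w (w + s%:C * iu) = dot w w + s * cross u w.
  by rewrite /dot /cross /iu; case: (u) (w) => [a b] [c d] /=; ring.
have -> : cross u (w + s%:C * iu) = cross u w + s * dot u u.
  by rewrite /dot /cross /iu; case: (u) (w) => [a b] [c d] /=; ring.
have := dot_gt0 _ u0; have := dot_gt0 _ w0; rewrite /s; case: ifPn.
  by move=> c0 w1 u1; split; [lra|rewrite gt_eqF //; lra].
by rewrite -ltNge => c0 w1 u1; split; [lra|rewrite lt_eqF //; lra].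
Qed.

Definition triple (a b c : C) (j : 'I_3) : C :=
  if j == 0 then a else if j == 1 then b else c.

(** The points [x], [y] with different phases are kept, and the third point
    runs along [x + t p].  Were [remainder h] constant, equal to [k], the term
    in [t^3], with coefficient [|p|^2 dot w p], would be bounded by [b t^2]. *)
Lemma remainder_nonconstant h :
  nonconstant_mod_pi h -> nonconstant_on (@noncollinear R) (remainder h).
Proof.
move=> [x [y xy]].
have g0 : phase h y - phase h x != 0.
  rewrite subr_eq0; apply/eqP => /esym/expi2_inj_mod_pi[k kE].
  exact: xy k kE.
set u := y - x.
have u0 : u != 0 by apply: contraNneq g0 => /subr0_eq ->; rewrite subrr.
(* When the third point is [x + t p], the coefficient of [t^3] in the numerator
   of [remainder_cross] is [- |p|^2 Re (w p^* )]. *)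
set w := (phase h y - phase h x) * cj u.
have w0 : w != 0 by rewrite mulf_neq0 ?conjc_eq0.
have [p [wp up]] := direction_exists u0 w0.
pose z t := triple x y (x + t%:C * p).
have cz t : cross (z t 1 - z t 0) (z t 2 - z t 0) = t * cross u p.
  rewrite /z /triple /= -/u [x + _]addrC addrK /cross.
  by case: (u) (p) => [a b] [c d] /=; ring.
have nc t : 1 <= t -> noncollinear (z t).
  move=> t1; apply/noncollinearE; rewrite cz mulf_neq0 // gt_eqF //.
  exact: lt_le_trans t1.
apply: contrapT => cst.
pose k := remainder h (z 1).
have kE t : 1 <= t -> remainder h (z t) = k.
  move=> t1; apply: contrapT => tk; apply: cst.
  by exists (z t), (z 1); split => //; exact: nc.
pose b := normc p ^+ 2 * normc (w * cj u)
  + 2 * normc u ^+ 2 * normc p * (normc p + normc u)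
  + (2 * cross u p) ^+ 2 * `|k|.
have : normc p ^+ 2 * dot w p <= 0.
  apply: (@linear_bound_le0 _ b) => t t1.
  have t0 : 0 < t by exact: lt_le_trans t1.
  have := remainder_cross h (nc t t1).
  rewrite /= cz kE // /z /triple /= -/u [x + _]addrC addrK.
  set G2 := phase h (_ + x) - _.
  (* Sort by powers of [t]; the last term is at most of order [t^2],
     by [BB]. *)
  have -> : ((phase h y - phase h x) * (t%:C * p) - G2 * u) *
     cj (u * (t%:C * p) * (u - t%:C * p)) =
     (t ^+ 2)%:C * ((normc p ^+ 2)%:C * (w * cj u))
     - (t ^+ 3)%:C * ((normc p ^+ 2)%:C * (w * cj p))
     + t%:C * ((normc u ^+ 2)%:C * (G2 * (cj p * (t%:C * cj p - cj u)))).
    clearbody u; rewrite !normcC_sqr /w !rmorphXn !rmorphM !rmorphB !rmorphM /=.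
    have -> : t -i* 0 = t%:C by rewrite oppr0.
    by ring.
  rewrite ReD ReB !ReZ.
  have -> : Re (w * cj p) = dot w p.
    by case: (w) (p) => [a c] [d e]; rewrite /dot /=; ring.
  set A := Re (w * cj u); set B := Re (G2 * _).
  have AB : A <= normc (w * cj u).
    by apply: le_trans (Re_le_normc _); exact: ler_norm.
  have BB : B <= t * (2 * normc p * (normc p + normc u)).
    apply: le_trans (ler_norm _) _; apply: le_trans (Re_le_normc _) _.
    rewrite !Normc.normcM.
    have G2le : normc G2 <= 2.
      rewrite /G2; apply: le_trans (le_normcD _ _) _.
      by rewrite normcN !normc_expi.
    have nt : normc (t%:C * cj p - cj u) <= t * (normc p + normc u).
      apply: le_trans (le_normcD _ _) _.
      rewrite normcN Normc.normcM !normc_conj.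
      have -> : normc t%:C = t.
        by rewrite /= expr0n addr0 sqrtr_sqr ger0_norm // ltW.
      by rewrite mulrDr lerD2l ler_peMl // normc_ge0.
    rewrite normc_conj.
    have -> : t * (2 * normc p * (normc p + normc u)) =
       2 * (normc p * (t * (normc p + normc u))) by ring.
    by rewrite ler_pM ?mulr_ge0 ?normc_ge0 // ler_wpM2l ?normc_ge0.
  move=> E; rewrite -(ler_pM2l (exprn_gt0 2 t0)).
  have -> : t ^+ 2 * (t * (normc p ^+ 2 * dot w p)) =
      t ^+ 2 * (normc p ^+ 2 * A) + t * (normc u ^+ 2 * B)
      + t ^+ 2 * ((2 * cross u p) ^+ 2 * - k).
    by apply: subr0_eq; move/eqP: E; rewrite -subr_eq0 => /eqP <-; ring.
  rewrite /b !mulrDr; apply: lerD; first apply: lerD.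
  - by rewrite !ler_wpM2l ?sqr_ge0.
  - apply: (@le_trans _ _ (t * (normc u ^+ 2 *
        (t * (2 * normc p * (normc p + normc u)))))).
      by rewrite !ler_wpM2l ?sqr_ge0 // ltW.
    by rewrite le_eqVlt; apply/orP; left; apply/eqP; ring.
  - by rewrite !ler_wpM2l ?sqr_ge0 // -normrN ler_norm.
rewrite leNgt mulr_gt0 // exprn_gt0 // normc_gt0.
by apply: contraNneq up => ->; rewrite /cross /= !mulr0 subr0.
Qed.

(** * Angles of a positively oriented triangle *)

Lemma angle_sym (p q r : C) : angle p q r = angle p r q.
Proof.
rewrite /angle [normc _ * _]mulrC; congr (acos (_ / _)).
by rewrite /dot ![Re (r - p) * _]mulrC ![Im (r - p) * _]mulrC.
Qed.

(** [(q - p)^* (r - p)] has real part [dot] and imaginary part [cross], so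
    with [cross] positive its argument is the unoriented angle. *)
Lemma expi_angle (p q r : C) : 0 < cross (q - p) (r - p) ->
  cj (q - p) * (r - p) =
  (normc (q - p))%:C * (normc (r - p))%:C * expi (angle p q r).
Proof.
move=> c0; rewrite -[LHS]expi_Arg.
  rewrite Normc.normcM normc_conj rmorphM /=; congr (_ * expi _).
  have [eR eI] : Re (cj (q - p) * (r - p)) = dot (q - p) (r - p) /\
      Im (cj (q - p) * (r - p)) = cross (q - p) (r - p) by rewrite conj_mulE.
  by rewrite /angle /Arg eR eI ltW // Normc.normcM normc_conj.
by rewrite conj_mulE eq_complex /= negb_and [cross _ _ == _]gt_eqF // orbT.
Qed.

(** The polar forms of [u], [v] and [u - v] are recovered one after the other
    from the argument of [u] and the angles at [z 0] and [z 1]. *)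
Lemma remainder_admissible h z : admissible z ->
  remainder h z = admissible_formula h z.
Proof.
case=> nc _; set u := z 1 - z 0; set v := z 2 - z 0 => c0.
have [u0 v0 uv0] : [/\ u != 0, v != 0 & u - v != 0].
  by apply: sides_neq0; rewrite area_form_neq0 gt_eqF.
have z01 : z 0 - z 1 = - u by rewrite opprB.
have z02 : z 0 - z 2 = - v by rewrite opprB.
have z12 : z 1 - z 2 = u - v by rewrite /u /v; ring.
have z21 : z 2 - z 1 = - (u - v) by rewrite /u /v; ring.
have l1_0 : normc (u - v) != 0 by rewrite normc_eq0.
have l2_0 : normc v != 0 by rewrite normc_eq0.
have l3_0 : normc u != 0 by rewrite normc_eq0.
have angle0 : cj u * v =
    (normc u)%:C * (normc v)%:C * expi (angle (z 0) (z 1) (z 2)).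
  exact: expi_angle.
have angle1 : cj (u - v) * u =
    (normc (u - v))%:C * (normc u)%:C * expi (angle (z 1) (z 0) (z 2)).
  have c1 : 0 < cross (z 2 - z 1) (z 0 - z 1).
    rewrite z01 z21; move: c0; rewrite /cross.
    by case: (u) (v) => [a b] [c d] /= ?; lra.
  by have := expi_angle c1; rewrite angle_sym z01 z21 !normcN rmorphN mulrNN.
have [m1 m2] := (remainder_menger h nc, menger_cross nc).
rewrite /= -/u -/v in m1 m2.
have cr0 : cross u v != 0 by rewrite gt_eqF.
rewrite /admissible_formula /frak_h /area z01 z02 z12 -/u -/v !normcN.
rewrite gtr0_norm //.
set t1 := angle _ _ _ in angle0 *; set t2 := angle _ _ _ in angle1 *.
set l1 := normc (u - v) in l1_0 angle1 m2 *.
set l2 := normc v in l2_0 angle0 m2 *.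
set l3 := normc u in l3_0 angle0 angle1 m2 *.
set al := Arg u.
have uE : u = l3%:C * expi al by rewrite expi_Arg.
have l1C : l1%:C != 0 by rewrite fmorph_eq0.
have l2C : l2%:C != 0 by rewrite fmorph_eq0.
have l3C : l3%:C != 0 by rewrite fmorph_eq0.
have ea := expi_neq0 al; have e1 := expi_neq0 t1; have e2 := expi_neq0 t2.
have vE : v = l2%:C * (expi al * expi t1).
  have cuE : cj u = l3%:C * (expi al)^-1.
    by rewrite {1}uE conj_polar.
  apply: (mulfI (x := cj u)); first by rewrite conjc_eq0.
  by rewrite angle0 cuE; field.
have uvE : u - v = l1%:C * (expi al / expi t2).
  have conj_uvE : cj (u - v) = l1%:C * expi (t2 - al).
    apply: (mulIf u0); rewrite angle1 {1}uE expiD expiN conj_expi; field.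
    exact: ea.
  rewrite -[LHS]conjcK conj_uvE conj_polar expiD expiN conj_expi; field.
  by rewrite ea e2.
set P := Re _ in m1.
suff key : l1 * cos (2 * h (z 0) - 2 * al - t1)
    + l2 * cos (2 * h (z 1) - 2 * al + t2)
    - l3 * cos (2 * h (z 2) - 2 * al + t2 - t1) = l1 * l2 * l3 * P.
  rewrite key -m1; rewrite !Normc.normcM -/l1 -/l2 -/l3 in m2.
  have -> : l1 * l2 * l3 / (4 * (cross u v / 2)) ^+ 2
        * (l1 * l2 * l3 * (menger z ^+ 2 * remainder h z)) =
      menger z ^+ 2 * (l3 * l2 * l1) ^+ 2 / (2 * cross u v) ^+ 2
        * remainder h z.
    by field.
  by rewrite m2 divff ?mul1r // expf_neq0 // mulf_neq0 // pnatr_eq0.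
have cosE (w : C) (a b : R) :
    cos (2 * h w - 2 * a + b) = Re (phase h w / expi a ^+ 2 * expi b).
  have e2a : expi (2 * a) = expi a ^+ 2 by rewrite mulr_natl mulr2n expiD.
  by rewrite -[LHS]/(Re (expi _)) expiD expiD expiN conj_expi e2a.
rewrite -[_ + t2 - t1]addrA !cosE expiD expiN conj_expi -!ReZ -ReD -ReB.
congr Re; rewrite uvE uE vE !rmorphM /=.
move: (phase _ _) (phase _ _) (phase _ _) => p0 p1 p2.
by field; rewrite ea e1 e2 l1C l2C l3C.
Qed.

End SymmetrizedKernels.

Theorem proposition2p2 (R : realType) (h : R[i] -> R)
    (h_nonconstant : nonconstant_on [set: R[i]] h) :
  exists Rh : ('I_3 -> R[i]) -> R,
    [/\ nonconstant_mod_pi h -> nonconstant_on (@noncollinear R) Rh,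
        forall (z : 'I_3 -> R[i]) (s : 'S_3),
          noncollinear z -> Rh (z \o s) = Rh z,
        forall z : 'I_3 -> R[i], noncollinear z ->
          symmetrize (re_kernel (Kh h)) z
            = (menger z ^+ 2 * (1 / 2 + Rh z))%:C
          /\ symmetrize (im_kernel (Kh h)) z
            = (menger z ^+ 2 * (1 / 2 - Rh z))%:C
      & forall z : 'I_3 -> R[i], admissible z ->
          Rh z = admissible_formula h z].
Proof.
exists (remainder h); split.
- exact: remainder_nonconstant.
- by move=> z s _; exact: remainder_perm.
- by move=> z nc; split; [exact: remainder_re|exact: remainder_im].
- exact: remainder_admissible.
Qed.
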